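(* Let $K$ be a separable metric space and assume that $K^{(j)}$, the $j$-th derived set of $K$, is non-empty for all $j=1,2,\ldots$. Then there exists a function $f$ on $K$ which is in $DBSC(K)$ but not in $SD(K)$.
   Context: For a topological Hausdorff space $M$, $M'$ denotes the set of cluster points of $M$; $K^{(0)}=K$ and $K^{(j+1)}=(K^{(j)})'$ for all $j$. Let $K$ be a separable metric space. $DBSC(K)$ is the set of all $f:K\to\mathbb{R}$ of the form $f=u-v$ with $u,v$ bounded lower semi-continuous on $K$; its members are called $D$-functions. Equivalently (Baire), $f\in DBSC(K)$ iff there is a sequence $(\varphi_j)$ of continuous real functions on $K$ with $\sup_{k\in K}\sum_j|\varphi_j(k)|<\infty$ and $f=\sum_j\varphi_j$ pointwise; $\|f\|_D$ denotes the infimum of $\sup_{k\in K}\sum_j|\varphi_j(k)|$ over all such sequences. $DBSC(K)$ with $\|\cdot\|_D$ is a Banach algebra. A simple $D$-function is a $D$-function taking only finitely many values. $SD(K)$ (the strong $D$-functions) is the set of $f:K\to\mathbb{R}$ for which there is a sequence $(\varphi_n)$ of simple $D$-functions on $K$ with $\|f-\varphi_n\|_D\to0$. *)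

(* Defs.v *)
From HB Require Import structures.
From mathcomp Require Import all_boot all_order all_algebra.
From mathcomp Require Import all_classical all_reals all_analysis.

Set Implicit Arguments.
Unset Strict Implicit.
Unset Printing Implicit Defensive.

Import Order.TTheory GRing.Theory Num.Theory.
Import numFieldNormedType.Exports.

Local Open Scope classical_set_scope.
Local Open Scope ring_scope.

Definition separable_space (T : topologicalType) : Prop :=
  exists2 S : set T, countable S & dense S.

(* [limit_point M] is taken in the ambient space; intersecting with [M] gives
   the cluster points of [M] as a topological space in its own right. *)
Definition derived (T : topologicalType) (M : set T) : set T :=
  M `&` limit_point M.

Definition iter_derived (T : topologicalType) (j : nat) : set T :=
  iter j (@derived T) setT.

Arguments iter_derived : clear implicits.

Section D_functions.
Context {R : realType} {K : metricType R}.
Implicit Types (f : K -> R) (phi : nat -> K -> R).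

Definition DBSC : set (K -> R) := [set f | exists u v : K -> R,
  [/\ bounded_fun u, lower_semicontinuous (EFin \o u),
      bounded_fun v, lower_semicontinuous (EFin \o v) &
      f = u \- v]].

(* For empty [K] this is -oo; only nonempty [K] is meaningful. *)
Definition sup_abs_series phi : \bar R :=
  ereal_sup (range (fun k : K => \sum_(0 <= j <oo) `|phi j k|%:E)%E).

Definition D_representation f phi : Prop :=
  [/\ forall j, continuous (phi j),
      (sup_abs_series phi < +oo)%E &
      forall k, series (phi ^~ k) @ \oo --> f k].

(* The infimum over the empty family is +oo; by Baire's theorem, for nonempty
   [K], this happens exactly when [f] is not a D-function. *)
Definition normD f : \bar R :=
  ereal_inf [set sup_abs_series phi | phi in D_representation f].

Definition simple_D : set (K -> R) := DBSC `&` [set f | finite_set (range f)].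

Definition SD : set (K -> R) := [set f | exists phi : nat -> K -> R,
  (forall n, simple_D (phi n)) /\
  (normD (f \- phi n) @[n --> \oo] --> 0%E)].

End D_functions.

Arguments DBSC {R} K.
Arguments simple_D {R} K.
Arguments SD {R} K.

(* Main.v *)
(** A chain of [n] jumps of [f] is a point, a second point arbitrarily near it
    where [f] differs by at least [s], a third one arbitrarily near the second,
    and so on.  If [h] is D-small then there is a small nonnegative [w] (the sum
    of the [|phi_j|]) such that every jump of [h] is, up to an arbitrarily small
    error, at most the increment of [w]; so the total of the jumps of [h] along
    any chain is small.  A simple D-function has the same property with some
    bounded [w], and its nonzero jumps are bounded below, so it has boundedly
    many of them along a chain.  Hence [f] is not in [SD K] as soon as, for each
    [n], it has a chain of [n] jumps of size [1 / (n + 1)].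

    A point of the [n]-th derived set carries, by induction on [n], a lower
    semicontinuous function with such a chain: glue, along disjoint open sets
    accumulating at the point, raised copies of functions of rank [n - 1], with
    value 0 elsewhere.  A last gluing, over disjoint open sets [U_n] with [U_n]
    meeting the [n]-th derived set, puts all the ranks in a single function. *)

Require Import Defs.
From mathcomp Require Import all_boot all_order all_algebra.
From mathcomp Require Import all_classical all_reals all_analysis.
From mathcomp Require Import ring lra.

Set Implicit Arguments.
Unset Strict Implicit.
Unset Printing Implicit Defensive.

Import Order.TTheory GRing.Theory Num.Theory.
Import numFieldNormedType.Exports.

Local Open Scope classical_set_scope.
Local Open Scope ring_scope.

(** * Infinite sets near limit points, and gaps of finite ranges *)

Lemma infinite_limit_point (T : topologicalType) (E : set T) x :
  accessible_space T -> limit_point E x -> infinite_set E.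
Proof.
move=> T1 Ex finE.
have cl : closed (E `\ x).
  by apply: (accessible_finite_set_closed.1 T1); exact: finite_setD.
have nx : nbhs x (~` (E `\ x)).
  by apply: open_nbhs_nbhs; split; [exact: closed_openC|case=> _ /(_ erefl)].
by have [y [/eqP yx Ey]] := Ex _ nx; apply.
Qed.

Lemma finite_range_gap (R : realType) (T : Type) (g : T -> R) :
  finite_set (range g) ->
  exists2 d : R, 0 < d & forall x y, g x != g y -> d <= `|g x - g y|.
Proof.
move=> fing.
pose D := [set `|a - b| | a in range g & b in range g] `\ 0.
have cD : closed D.
  apply: accessible_finite_set_closed.1.
    exact: hausdorff_accessible (@Rhausdorff R).
  by apply: finite_setD; exact: finite_image2.
have /nbhs_ballP[d /= d0 dD] : nbhs (0 : R) (~` D).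
  by apply: open_nbhs_nbhs; split; [exact: closed_openC|case=> _ /(_ erefl)].
exists d => // x y gxy; rewrite leNgt; apply/negP => ltd.
apply: (dD `|g x - g y|); first by rewrite /ball/= sub0r normrN normr_id.
split; first by exists (g x); [exists x|exists (g y) => //; exists y].
by move/eqP; rewrite normr_eq0 subr_eq0 (negbTE gxy).
Qed.

(** * Disjoint open sets meeting a decreasing sequence of infinite sets *)

Section disjoint_opens.
Context {R : realType} {K : metricType R}.
Implicit Types (A : nat -> set K) (W : set K).

Lemma open_mdist_gt (p : K) (r : R) : open [set y | r < mdist p y].
Proof.
rewrite openE => y /= ry; apply/nbhs_ballP; exists (mdist p y - r) => /=.
  by rewrite subr_gt0.
move=> z; rewrite ballEmdist /= => yz.
have := metric_triangle p z y; rewrite (metric_sym z y); lra.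
Qed.

Lemma open_mdist_lt (p : K) (r : R) : open [set y | mdist p y < r].
Proof.
rewrite openE => y /= ry; apply/nbhs_ballP; exists (r - mdist p y) => /=.
  by rewrite subr_gt0.
move=> z; rewrite ballEmdist /= => yz.
have := metric_triangle p y z; lra.
Qed.

Definition meets_infinitely A W := open W /\ forall n, infinite_set (W `&` A n).

(* Of two distinct points of [W `&` A n], at least one has a neighbourhood
   whose exterior in [W] still meets every [A m] in an infinite set. *)
Lemma split_open A W n : {homo A : m k / (m <= k)%N >-> k `<=` m} ->
  meets_infinitely A W ->
  exists U W', [/\ open U, U `&` A n !=set0, meets_infinitely A W',
                   U `&` W' = set0 & U `|` W' `<=` W].
Proof.
move=> decA [oW infW].
have [p [Wp Anp]] : W `&` A n !=set0 by exact: infinite_setN0.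
have [q [[Wq Anq] pq]] : (W `&` A n) `\ p !=set0.
  by apply: infinite_setN0; apply: infinite_setD.
pose r := mdist p q / 3.
have r0 : 0 < r by rewrite divr_gt0// mdist_gt0; apply/eqP => e; apply: pq.
have qr : 2 * r < mdist p q by move: r0; rewrite /r; lra.
have oi1 : open (W `&` [set y | r < mdist p y]).
  by apply: openI => //; exact: open_mdist_gt.
have oi2 : open (W `&` [set y | mdist p y < 2 * r]).
  by apply: openI => //; exact: open_mdist_lt.
have [inf1|] := pselect (forall m,
    infinite_set (W `&` [set y | r < mdist p y] `&` A m)).
  exists (W `&` [set y | mdist p y < r]), (W `&` [set y | r < mdist p y]).
  split => //.
  - by apply: openI => //; exact: open_mdist_lt.
  - by exists p; split => //; split => //=; rewrite mdistxx.
  - by rewrite -subset0 => y [[_ /= ?] [_ /=]]; lra.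
  - by move=> y [] [].
move=> /existsNP[m /contrapT fin1].
exists (W `&` [set y | 2 * r < mdist p y]), (W `&` [set y | mdist p y < 2 * r]).
split => //.
- by apply: openI => //; exact: open_mdist_gt.
- by exists q.
(* The sets [mdist p y < 2 * r] and [r < mdist p y] cover [K]. Finite traces on [A k] and [A m]
   would thus make [W] meet [A (maxn k m)] in a finite set. *)
- split=> // k fin2; apply: (infW (maxn k m)).
  apply: (@sub_finite_set _ _
    ((W `&` [set y | mdist p y < 2 * r] `&` A k) `|`
     (W `&` [set y | r < mdist p y] `&` A m))); last by rewrite finite_setU.
  move=> y [Wy Ay]; have [yr|yr] := ltP (mdist p y) (2 * r); [left|right].
    by split => //; apply: decA Ay; rewrite leq_maxl.
  split; [split => //=; lra|].
  by apply: decA Ay; rewrite leq_maxr.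
- by rewrite -subset0 => y [[_ /= ?] [_ /=]]; lra.
- by move=> y [] [].
Qed.

(** Iterate [split_open]: [U n] is cut off from the remaining set [W n], and all later choices lie
    in [W n.+1], which is disjoint from [U n]. *)
Lemma disjoint_opens A : {homo A : m k / (m <= k)%N >-> k `<=` m} ->
  (forall n, infinite_set (A n)) ->
  exists U : nat -> set K, [/\ forall n, open (U n), trivIset setT U &
    forall n, U n `&` A n !=set0].
Proof.
move=> decA infA.
pose step (n : nat) (W : set K) (P : set K * set K) :=
  [/\ open P.1, P.1 `&` A n !=set0, meets_infinitely A P.2,
     P.1 `&` P.2 = set0 & P.1 `|` P.2 `<=` W].
have next n W : {P | meets_infinitely A W -> step n W P}.
  apply: cid; have [gW|] := pselect (meets_infinitely A W); last first.
    by exists (set0, set0).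
  by have [U [W' ?]] := split_open n decA gW; exists (U, W').
pose fix W n := if n is m.+1 then (sval (next m (W m))).2 else setT.
have gW n : meets_infinitely A (W n).
  elim: n => [|n IH] /=.
    by split; [exact: openT|move=> n; rewrite setTI; exact: infA].
  by have [] := svalP (next n (W n)) IH.
pose U n := (sval (next n (W n))).1.
have stepU n : step n (W n) (U n, W n.+1).
  by rewrite /U /= -surjective_pairing; exact: svalP (next n (W n)) (gW n).
have WS n m : (n <= m)%N -> W m `<=` W n.
  move=> /subnK <-; elim: (m - n)%N => [//|k IH] y Wy.
  by apply: IH; have [_ _ _ _ +] := stepU (k + n)%N; apply; right.
exists U; split=> [n||n]; [by have [] := stepU n| |by have [] := stepU n].
have disj i j y : (i < j)%N -> U i y -> U j y -> False.
  move=> ij Ui Uj; have [_ _ _ + _] := stepU i; rewrite -subset0 => /(_ y).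
  apply; split => //=; apply: (WS i.+1 j ij).
  by have [_ _ _ _ +] := stepU j; apply; left.
move=> i j _ _ [y [Ui Uj]].
by have [/disj/(_ Ui Uj)//|/disj/(_ Uj Ui)//|//] := ltngtP i j.
Qed.

End disjoint_opens.

(** * Gluing functions along disjoint open sets *)

Section disjoint_glue.
Context {R : realType} {T I : Type} (U : I -> set T) (f : I -> T -> R).

Definition disjoint_glue (x : T) : R :=
  if pselect (exists i, U i x) is left h then f (sval (cid h)) x else 0.

Lemma disjoint_glue_in i x :
  trivIset setT U -> U i x -> disjoint_glue x = f i x.
Proof.
move=> trU Ux; rewrite /disjoint_glue.
case: pselect => [h|]; last by case; exists i.
by case: cid => j /= Uj; rewrite (trU i j) //; exists x.
Qed.

Lemma disjoint_glue_out x : (forall i, ~ U i x) -> disjoint_glue x = 0.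
Proof.
by move=> nU; rewrite /disjoint_glue; case: pselect => // h; have [i /nU] := h.
Qed.

Lemma disjoint_glue_ge0 x : (forall i x, 0 <= f i x) -> 0 <= disjoint_glue x.
Proof.
by move=> f0; rewrite /disjoint_glue; case: pselect => // h; exact: f0.
Qed.

Lemma disjoint_glue_le c x :
  0 <= c -> (forall i x, f i x <= c) -> disjoint_glue x <= c.
Proof.
by move=> c0 fc; rewrite /disjoint_glue; case: pselect => // h; exact: fc.
Qed.

End disjoint_glue.

(* Outside the open sets the glued function takes its minimum 0, so lower
   semicontinuity there is automatic. *)
Lemma disjoint_glue_lsc (R : realType) (T : topologicalType) (I : Type)
    (U : I -> set T) (f : I -> T -> R) :
  (forall i, open (U i)) -> trivIset setT U -> (forall i x, 0 <= f i x) ->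
  (forall i, lower_semicontinuous (EFin \o f i)) ->
  lower_semicontinuous (EFin \o disjoint_glue U f).
Proof.
move=> oU trU f0 lf x a /=.
have [[i Ux]|/forallNP nU] := pselect (exists i, U i x).
  rewrite (disjoint_glue_in f trU Ux) => /lf[V nV HV].
  exists (U i `&` V).
    by apply: filterI => //; apply: open_nbhs_nbhs; split.
  by move=> y [Uy Vy]; rewrite (disjoint_glue_in f trU Uy); exact: HV.
rewrite (disjoint_glue_out f nU) lte_fin => a0.
exists setT; first exact: filterT.
by move=> y _; rewrite lte_fin (lt_le_trans a0)// disjoint_glue_ge0.
Qed.

(** * Chains of jumps *)

Section descends.
Context {R : realType} {T : topologicalType}.
Implicit Types (f g : T -> R).

Fixpoint descends f (s : R) (n : nat) (x : T) : Prop :=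
  if n is m.+1 then forall V, nbhs x V ->
    exists y, [/\ V y, s <= `|f y - f x| & descends f s m y]
  else True.

(** Each point of a chain can be taken in the open set [U], and the constant [c] cancels in the
    jumps. *)
Lemma descends_local f g (U : set T) (c s : R) n x : open U ->
  (forall y, U y -> f y = g y + c) -> U x ->
  descends g s n x -> descends f s n x.
Proof.
move=> oU fg; elim: n x => // n IH x Ux /= gx V nV.
have [|y [[Vy Uy] sy gy]] := gx (V `&` U).
  by apply: filterI => //; apply: open_nbhs_nbhs; split.
exists y; split => //; last exact: IH.
by rewrite !fg// [X in `|X|](_ : _ = g y - g x)//; lra.
Qed.

(** Take each next point where the estimate at the current one holds; the increments of [W]
    telescope. *)
Lemma descends_rise f (W : T -> R) (s e : R) n x :
  (forall x, \forall y \near x, s <= `|f y - f x| -> s <= W y - W x + e) ->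
  descends f s n x -> exists y, n%:R * (s - e) <= W y - W x.
Proof.
move=> rise; elim: n x => [|n IH] x; first by exists x; rewrite mul0r subrr.
move=> /(_ _ (rise x))[y [/= rxy sy /IH[z Hz]]]; exists z.
by have := rxy sy; rewrite -natr1 mulrDl mul1r; lra.
Qed.

End descends.

(** * Functions with long chains at points of the derived sets *)

Section metric.
Context {R : realType} {K : metricType R}.

Lemma iter_derivedS n (x : K) :
  iter_derived K n.+1 x ->
  iter_derived K n x /\ limit_point (iter_derived K n) x.
Proof. by []. Qed.

Lemma accessible_metric : accessible_space K.
Proof. exact/hausdorff_accessible/metric_hausdorff. Qed.

Lemma descending_function (s : R) n (x : K) : 0 <= s -> iter_derived K n x ->
  exists f : K -> R, [/\ lower_semicontinuous (EFin \o f),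
    forall y, 0 <= f y <= n%:R * s & descends f s n x].
Proof.
move=> s0; elim: n x => [|n IH] x.
  move=> _; exists (fun=> 0); split=> //= [y a lta|y].
    by exists setT => //; exact: filterT.
  by rewrite mul0r lexx.
move=> /iter_derivedS[_ limx].
(* The balls make the points [p i] chosen below converge to [x]; the open sets [U i] themselves need
   not shrink to [x]. *)
pose A i := (iter_derived K n `&` ball x i.+1%:R^-1) `\ x.
have [|i|U [oU trU UA]] := @disjoint_opens R K A.
- move=> i j ij y [[Dy By] yx]; split=> //; split => //.
  by apply: le_ball By; rewrite lef_pV2 ?posrE// ler_nat.
- apply: infinite_setD; last exact: finite_set1.
  apply: (@infinite_limit_point _ _ x) accessible_metric _.
  move=> V nV; have [|y [yx Dy [Vy By]]] := limx (V `&` ball x i.+1%:R^-1).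
    by apply: filterI => //; apply: near_ball; rewrite invr_gt0.
  by exists y.
have /choice[p Hp] i : exists p, (U i `&` A i) p by case: (UA i) => p; exists p.
have /choice[f Hf] i : exists f : K -> R, [/\ lower_semicontinuous (EFin \o f),
    forall y, 0 <= f y <= n%:R * s & descends f s n (p i)].
  by apply: IH; have [_ [[]]] := Hp i.
(* Some [U i] may contain [x]; removing [x] forces the glued function to be 0 there, so that raising
   by [s] yields the first jump. *)
pose U' i := U i `&` ~` [set x].
have oU' i : open (U' i).
  by apply: openI => //; apply: closed_openC;
     exact: accessible_closed_set1 accessible_metric _.
have trU' : trivIset setT U'.
  by move=> i j _ _ [y [[Ui _] [Uj _]]]; apply: trU => //; exists y.
pose f' i y := f i y + s.
have f'0 i y : 0 <= f' i y.
  by have [_ /(_ y)/andP[? _] _] := Hf i; rewrite addr_ge0.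
exists (disjoint_glue U' f'); split.
- apply: disjoint_glue_lsc => // i y a.
  rewrite /f' /= lte_fin -ltrBlDr -lte_fin => ay.
  have [/(_ y (a - s))[//|V nV HV] _ _] := Hf i.
  by exists V => // z /HV /=; rewrite !lte_fin ltrBlDr.
- move=> y; rewrite disjoint_glue_ge0//= disjoint_glue_le//.
    by rewrite mulr_ge0.
  move=> i z; have [_ /(_ z)/andP[_ ?] _] := Hf i.
  by rewrite -natr1 mulrDl mul1r lerD2r.
- move=> V /nbhs_ballP[e /= e0 eV].
  have [i] := ltr_add_invr e0; rewrite add0r => ie.
  have [Ui [[Di Bi] pix]] := Hp i.
  have Up : U' i (p i) by split.
  exists (p i); split.
  + by apply: eV; apply: le_ball Bi; exact: ltW.
  + rewrite (disjoint_glue_in f' trU' Up) disjoint_glue_out; last first.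
      by move=> j [_ /(_ erefl)].
    rewrite subr0 ger0_norm ?f'0// lerDr.
    by have [_ /(_ (p i))/andP[]] := Hf i.
  + apply: (@descends_local _ _ _ (f i) (U' i) s) => //.
      by move=> y Uy; exact: disjoint_glue_in.
    by have [] := Hf i.
Qed.

End metric.

(** * Control of the oscillation of D-functions *)

Lemma lower_semicontinuous_near (R : realType) (T : topologicalType)
    (u : T -> R) x (e : R) :
  lower_semicontinuous (EFin \o u) -> 0 < e ->
  \forall y \near x, u x - e < u y.
Proof.
move=> lu e0; have [|V nV HV] := lu x (u x - e); first by rewrite lte_fin; lra.
by apply: filterS nV => y /HV; rewrite lte_fin.
Qed.

Lemma bounded_funP (R : realType) (T : Type) (u : T -> R) :
  bounded_fun u <-> exists M, forall x, `|u x| <= M.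
Proof.
split=> [[M [_ HM]]|[M HM]].
  by exists (M + 1) => x; apply: HM => //; rewrite ltrDl.
exists M; split; first exact: num_real.
by move=> N MN x _ /=; exact: le_trans (HM x) (ltW MN).
Qed.

Lemma continuous_sum_nat (R : realType) (T : topologicalType)
    (phi : nat -> T -> R) n :
  (forall j, continuous (phi j)) ->
  continuous (fun x => \sum_(0 <= j < n) phi j x).
Proof.
move=> cphi; elim: n => [|n IH].
  rewrite (_ : (fun x => _) = cst 0); first exact: cst_continuous.
  by apply/funext => x; rewrite big_nil.
rewrite (_ : (fun x => _) = (fun x => \sum_(0 <= j < n) phi j x) \+ phi n).
  by move=> x; apply: cvgD; [exact: IH|exact: cphi].
by apply/funext => x; rewrite big_nat_recr.
Qed.

Section oscillation.
Context {R : realType} {K : metricType R}.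
Implicit Types (g h w : K -> R).

Definition oscillation_control h w := forall x (e : R), 0 < e ->
  \forall y \near x, `|h y - h x| <= w y - w x + e.

(** For [w = u + v], the increment of [w] minus or plus that of [g = u - v] is twice that of [v] or
    [u], which is nearly nonnegative by semicontinuity. *)
Lemma DBSC_control g : DBSC K g ->
  exists w (C : R), oscillation_control g w /\ forall x, `|w x| <= C.
Proof.
move=> [u [v [/bounded_funP[Mu bu] lu /bounded_funP[Mv bv] lv ->]]].
exists (u \+ v), (Mu + Mv); split=> [x e e0|x]; last first.
  by rewrite (le_trans (ler_normD _ _))// lerD.
have e20 : 0 < e / 2 by rewrite divr_gt0.
near=> y.
have : u x - e / 2 < u y by near: y; exact: lower_semicontinuous_near.
have : v x - e / 2 < v y by near: y; exact: lower_semicontinuous_near.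
by rewrite ler_norml /= => ? ?; apply/andP; split; lra.
Unshelve. all: by end_near. Qed.

Lemma normD_control h (r : R) : (normD h < r%:E)%E ->
  exists w, oscillation_control h w /\ forall x, 0 <= w x <= r.
Proof.
move=> /ereal_inf_lt[_ [phi [cphi _ Sh] <-]] ltr.
pose S n x := \sum_(0 <= j < n) phi j x.
pose A n x : R := \sum_(0 <= j < n) `|phi j x|.
have Ar n x : A n x <= r.
  rewrite -lee_fin (le_trans _ (ltW ltr))//.
  apply: le_trans (ereal_sup_ubound _); last by exists x.
  rewrite /A -sumEFin; apply: nneseries_lim_ge => j _ _.
  by rewrite lee_fin.
pose w x := sup (range (A ^~ x)).
have supA x : has_sup (range (A ^~ x)).
  split; first by exists (A 0%N x), 0%N.
  by exists r => _ [n _ <-].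
have Aw n x : A n x <= w x.
  by apply: sup_upper_bound; [exact: supA|exists n].
(* Bound [S n x - S J x] by [A n x - A J x], then let [n] grow. *)
have tail J x : `|h x - S J x| <= w x - A J x.
  apply/ler_addgt0Pr => e e0.
  have [n Jn hn] : exists2 n, (J <= n)%N & `|h x - S n x| < e.
    have [N _ HN] := (cvgrPdist_lt _ _).1 (Sh x) e e0.
    exists (maxn J N); first exact: leq_maxl.
    by apply: HN; exact: leq_maxr.
  have : `|S n x - S J x| <= A n x - A J x.
    rewrite (_ : S n x - S J x = \sum_(J <= j < n) phi j x); last first.
      by rewrite -(sub_series_geq (phi ^~ x) Jn).
    rewrite (_ : A n x - A J x = \sum_(J <= j < n) `|phi j x|).
      exact: ler_norm_sum.
    by rewrite -(sub_series_geq (fun j => `|phi j x|) Jn).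
  have := Aw n x; have := ler_distD (S n x) (h x)
    (S J x); lra.
exists w; split => [x e e0|x]; last first.
  apply/andP; split; first by rewrite (le_trans _ (Aw 0%N x))// /A big_nil.
  by apply: ge_sup => [|_ [n _ <-]//]; exists (A 0%N x), 0%N.
have e40 : 0 < e / 4 by rewrite divr_gt0.
(* Only the tail at [x] is made small by [J]; the tail at [y] is paid for by [w y]. The errors are
   this tail, [S J] once, and [A J] and [w x] in replacing [A J y] by [w x]. *)
have [_ [J _ <-] wJ] := sup_adherent e40 (supA x).
have cA : continuous (A J).
  apply: continuous_sum_nat => j y.
  by apply: continuous_comp (@norm_continuous _ _ _); exact: cphi.
have cS : continuous (S J) by exact: continuous_sum_nat.
near=> y.
have : `|S J x - S J y| < e / 4.
  near: y; exact: ((cvgrPdist_lt _ _).1 (cS x) _ e40).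
have : `|A J x - A J y| < e / 4.
  by near: y; exact: ((cvgrPdist_lt _ _).1 (cA x) _ e40).
move: (tail J x) (tail J y) wJ; rewrite -/(w x).
rewrite !ler_norml !ltr_norml.
move=> /andP[? ?] /andP[? ?] ? /andP[? ?] /andP[? ?]; apply/andP; split; lra.
Unshelve. all: by end_near. Qed.

(* If a jump of [f = g + h] by [s] is not entirely due to [h], then [g] changes
   value, hence jumps by at least [d]; this costs only [s / d] per unit of
   [wg]. *)
Lemma jump_rise (f g wg wh : K -> R) (s d e : R) x :
  0 <= s -> 0 < d -> 0 < e ->
  oscillation_control g wg -> oscillation_control (f \- g) wh ->
  (forall x y, g x != g y -> d <= `|g x - g y|) ->
  let W x := wh x + s / d * wg x in
  \forall y \near x, s <= `|f y - f x| -> s <= W y - W x + e.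
Proof.
move=> s0 d0 e0 cg ch gap W.
pose c := s / d; have c0 : 0 <= c by rewrite divr_ge0// ltW.
(* The errors of the two controls, with weights 1 and [c], then add up to [e]. *)
pose e' := e / (1 + c).
have e'0 : 0 < e' by rewrite divr_gt0// ltr_wpDr.
have ee' : e = e' + c * e'.
  by rewrite -{1}[e']mul1r -mulrDl mulrC divfK// gt_eqF// ltr_wpDr.
near=> y => sf.
have Hg : `|g y - g x| <= wg y - wg x + e' by near: y; exact: cg.
have Hh : `|(f \- g) y - (f \- g) x| <= wh y - wh x + e' by near: y; exact: ch.
have -> : W y - W x + e = (wh y - wh x + e') + c * (wg y - wg x + e').
  by rewrite ee' /W -/c; ring.
have [gyx|/gap gyx] := eqVneq (g y) (g x).
  have : 0 <= c * (wg y - wg x + e') by rewrite mulr_ge0// (le_trans _ Hg).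
  move: Hh; rewrite /= gyx (_ : f y - g x - _ = f y - f x); last by ring.
  lra.
have : c * d <= c * (wg y - wg x + e') by rewrite ler_wpM2l// (le_trans gyx).
rewrite /c divfK ?gt_eqF// => ?.
by move: Hh => /(le_trans (normr_ge0 _)); lra.
Unshelve. all: by end_near. Qed.

Lemma not_SD (f : K -> R) :
  (forall n, exists x, descends f n.+1%:R^-1 n x) -> ~ SD K f.
Proof.
move=> desc [phi [simple cvg0]].
have [n fn] : exists n, (normD (f \- phi n)%R < (1 / 4)%:E)%E.
  have [|N _ HN] := cvg0 [set z | (z < (1 / 4)%:E)%E].
    by apply: (@nbhs_open_ereal_lt _ _ (fun=> 1 / 4)); lra.
  by exists N; apply: HN => /=.
have [Dg fing] := simple n; move: fn Dg fing; set g := phi n.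
move=> /normD_control[wh [ch whr]] /DBSC_control[wg [C [cg wgC]]].
move=> /finite_range_gap[d d0 gap].
(* With [s = 1 / (k + 1)] below both bounds, [wh] and the weighted [wg] each rise by at most 1/4,
   while the chain forces a rise of 7/8 (1 - s) > 21/32 > 1/2. *)
have [k] : exists k : nat,
    0 + k.+1%:R^-1 < Num.min (1 / 4) (d / (8 * (`|C| + 1))).
  apply: ltr_add_invr; rewrite lt_min; apply/andP; split; first lra.
  by rewrite divr_gt0// mulr_gt0// ltr_wpDl.
rewrite add0r lt_min => /andP[]; set s := k.+1%:R^-1 => s4 sd.
have s0 : 0 < s by rewrite invr_gt0.
have ks : k%:R * s = 1 - s.
  by rewrite -[k%:R](addrK 1) natr1 mulrBl mul1r divff// pnatr_eq0.
have [x dx] := desc k.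
have s80 : 0 < s / 8 by rewrite divr_gt0.
have [y] := descends_rise (fun x => jump_rise x (ltW s0) d0 s80 cg ch gap) dx.
have : s / d * (wg y - wg x) <= 1 / 4.
  have c0 : 0 <= s / d by rewrite divr_ge0// ltW.
  apply: (@le_trans _ _ (s / d * (2 * (`|C| + 1)))).
    apply: ler_wpM2l => //; have := wgC y; have := wgC x.
    by have := ler_norm C; rewrite !ler_norml => ? /andP[? ?] /andP[? ?]; lra.
  move: sd; rewrite ltr_pdivlMr; last by rewrite mulr_gt0// ltr_wpDl.
  rewrite mulrAC ler_pdivrMr//; lra.
have := whr x; have := whr y => /andP[? ?] /andP[? ?].
have -> : k%:R * (s - s / 8) = 7 / 8 * (1 - s) by rewrite -ks; lra.
rewrite -/s; lra.
Qed.

End oscillation.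

Theorem proposition1p5 (R : realType) (K : metricType R)
    (sepK : separable_space K)
    (derK : forall j : nat, (0 < j)%N -> iter_derived K j !=set0) :
  exists f : K -> R, DBSC K f /\ ~ SD K f.
Proof.
have [||U [oU trU UA]] := @disjoint_opens R K (iter_derived K).
- move=> i j /subnK <-; elim: (j - i)%N => [//|k IH] x.
  by move=> /iter_derivedS[/IH].
(* A point of the next derived set makes the current one infinite. *)
- move=> n; have [x /iter_derivedS[_ limx]] := derK n.+1 isT.
  exact: infinite_limit_point accessible_metric limx.
have /choice[p Hp] n : exists p, (U n `&` iter_derived K n) p.
  by case: (UA n) => p; exists p.
(* Jump size 1 / (n + 1) for [n] jumps keeps all the [f n] below 1, so the glued function is
   bounded. *)
have /choice[f Hf] n : exists f : K -> R,
    [/\ lower_semicontinuous (EFin \o f),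
    forall y, 0 <= f y <= n%:R * n.+1%:R^-1 & descends f n.+1%:R^-1 n (p n)].
  by apply: descending_function; [rewrite invr_ge0|have [] := Hp n].
have f0 n y : 0 <= f n y by have [_ /(_ y)/andP[]] := Hf n.
have f1 n y : f n y <= 1.
  have [_ /(_ y)/andP[_ fy] _] := Hf n; apply: le_trans fy _.
  by rewrite ler_pdivrMr// mul1r ler_nat.
exists (disjoint_glue U f); split; last first.
  apply: not_SD => n; exists (p n).
  apply: (@descends_local _ _ _ (f n) (U n) 0) => //.
  - by move=> y Uy; rewrite addr0; exact: disjoint_glue_in.
  - by have [] := Hp n.
  - by have [] := Hf n.
exists (disjoint_glue U f), (fun=> 0); split.
- apply/bounded_funP; exists 1 => y /=.
  by rewrite ger0_norm ?disjoint_glue_ge0// disjoint_glue_le.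
- by apply: disjoint_glue_lsc => // i; have [] := Hf i.
- by apply/bounded_funP; exists 0 => y /=; rewrite normr0.
- by move=> x a ax; exists setT => //; exact: filterT.
- by apply/funext => y /=; rewrite subr0.
Qed.
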